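(* Let $(X,\mathcal{R})$ be a $d$-class $Q$-polynomial association scheme and $C$ a non-empty subset of $X$ with degree $s$, dual inner distribution $(b_0,\ldots,b_d)$ and matrices $F_0,\ldots,F_d$ as in the context. Assume there exists $w^*\in\{0,1,\ldots,d-s\}$ such that $b_{w^*}>0$ and $F_kF_l=0$ for all $(k,l)\in\{0,1,\ldots,w^*+s\}^2$ with $|k-l|\ge w^*+1$. Then $(C,\mathcal{R}^C)$ is an $s$-class $Q$-polynomial association scheme.
   Context: $(X,\mathcal{R})$ is a symmetric association scheme with relations $R_0,\ldots,R_d$, adjacency matrices $A_0=I,\ldots,A_d$ and primitive idempotents $E_0=\frac1{|X|}J,\ldots,E_d$, $Q$-polynomial with respect to $E_0,\ldots,E_d$. For $C\subseteq X$ with characteristic vector $\chi$: $b_i=\frac{|X|}{|C|}\chi^TE_i\chi$; degree set $S(C)=\{j:1\le j\le d,\ \chi^TA_j\chi\ne0\}$, degree $s=|S(C)|$. $F_i$ denotes the principal submatrix of $E_i$ with rows and columns indexed by $C$ (equivalently $F_i=\frac1{|X|}H_iH_i^T$ with $H_i=\Delta_CS_i$, $E_i=\frac1{|X|}S_iS_i^T$). $\mathcal{R}^C$ is the set of relations $R_i\cap(C\times C)$ for $i\in\{0\}\cup S(C)$. *)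

(* Defs.v *)
From HB Require Import structures.
From mathcomp Require Import all_boot all_order all_algebra.
From mathcomp Require Import reals.

Set Implicit Arguments.
Unset Strict Implicit.
Unset Printing Implicit Defensive.

Import Order.TTheory GRing.Theory Num.Theory.
Local Open Scope ring_scope.

(* Symmetric [d]-class association scheme on [X]: the relations [Rel i] are   *)
(* pairwise distinct, and [partition] makes them non-empty (so [X] is too).   *)
Record assoc_scheme (X : finType) (d : nat) (Rel : 'I_d.+1 -> {set X * X}) :
    Prop := AssocScheme {
  scheme_inj : injective Rel;
  scheme_partition : partition [set Rel i | i : 'I_d.+1] [set: X * X];
  scheme_diag : Rel ord0 = [set p : X * X | p.1 == p.2];
  scheme_sym : forall i x y, (x, y) \in Rel i -> (y, x) \in Rel i;
  scheme_intersection : forall i j k : 'I_d.+1, exists p : nat, forall x y,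
    (x, y) \in Rel k ->
    #|[set z | ((x, z) \in Rel i) && ((z, y) \in Rel j)]| = p
}.

(* Matrices with rows and columns indexed by [X] are [#|X|]-square matrices,  *)
(* through the bijection [enum_val : 'I_#|X| -> X].                           *)
Definition adj_mx (R : realType) (X : finType) (r : {set X * X}) :
    'M[R]_#|X| :=
  \matrix_(a, b) ((enum_val a, enum_val b) \in r)%:R.

Definition bose_mesner (R : realType) (X : finType) (d : nat)
    (Rel : 'I_d.+1 -> {set X * X}) : {vspace 'M[R]_#|X|} :=
  <<[tuple adj_mx R (Rel i) | i < d.+1]>>%VS.

Definition idempotent_in (R : realType) (n : nat) (B : {vspace 'M[R]_n})
    (e : 'M[R]_n) : Prop :=
  e \in B /\ e *m e = e.

Definition primitive_idempotent (R : realType) (n : nat)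
    (B : {vspace 'M[R]_n}) (e : 'M[R]_n) : Prop :=
  [/\ idempotent_in B e, e != 0
    & ~ exists f g, [/\ idempotent_in B f, idempotent_in B g,
          f != 0 /\ g != 0, f *m g = 0 /\ g *m f = 0 & e = f + g]].

(* [E] lists the primitive idempotents of the Bose-Mesner algebra, each of    *)
(* them exactly once, starting with [J / #|X|].                               *)
Record primitive_idempotents (R : realType) (X : finType) (d : nat)
    (Rel : 'I_d.+1 -> {set X * X}) (E : 'I_d.+1 -> 'M[R]_#|X|) : Prop :=
  PrimitiveIdempotents {
  idem_inj : injective E;
  idem_all : forall e,
    primitive_idempotent (bose_mesner R Rel) e <-> exists i, e = E i;
  idem0 : E ord0 = #|X|%:R^-1 *: const_mx 1
}.

(* For each [i], [|X| E_i = v_i(|X| E_1)] with [v_i] of degree exactly [i],   *)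
(* evaluated entrywise (that is, for the Hadamard product). When [d = 0],     *)
(* [inord 1] is [ord0] and the condition is void: the scheme on one point     *)
(* counts as [Q]-polynomial.                                                  *)
Record Q_polynomial (R : realType) (X : finType) (d : nat)
    (Rel : 'I_d.+1 -> {set X * X}) (E : 'I_d.+1 -> 'M[R]_#|X|) : Prop :=
  QPolynomial {
  Qpoly_idem : primitive_idempotents Rel E;
  Qpoly_poly : forall i : 'I_d.+1, exists v : {poly R},
    size v = i.+1 /\
    #|X|%:R *: E i = map_mx (horner v) (#|X|%:R *: E (inord 1))
}.

Definition char_vec (R : realType) (X : finType) (C : {set X}) :
    'cV[R]_#|X| :=
  \col_a (enum_val a \in C)%:R.

Definition dual_inner_distribution (R : realType) (X : finType) (d : nat)
    (E : 'I_d.+1 -> 'M[R]_#|X|) (C : {set X}) (i : 'I_d.+1) : R :=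
  #|X|%:R / #|C|%:R * ((char_vec R C)^T *m E i *m char_vec R C) 0 0.

Definition degree_set (R : realType) (X : finType) (d : nat)
    (Rel : 'I_d.+1 -> {set X * X}) (C : {set X}) : {set 'I_d.+1} :=
  [set j : 'I_d.+1 | (1 <= j)%N &&
    (((char_vec R C)^T *m adj_mx R (Rel j) *m char_vec R C) 0 0 != 0)].

Definition sub_carrier (X : finType) (C : {set X}) : finType :=
  {x : X | x \in C}.

Definition principal_submx (R : realType) (X : finType) (C : {set X})
    (M : 'M[R]_#|X|) : 'M[R]_#|sub_carrier C| :=
  let g (a : 'I_#|sub_carrier C|) := enum_rank (val (enum_val a)) in
  mxsub g g M.

Definition restrict_rel (X : finType) (C : {set X}) (r : {set X * X}) :
    {set sub_carrier C * sub_carrier C} :=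
  [set p | (val p.1, val p.2) \in r].

Definition induced_relations (R : realType) (X : finType) (d : nat)
    (Rel : 'I_d.+1 -> {set X * X}) (C : {set X}) :
    {set {set sub_carrier C * sub_carrier C}} :=
  [set restrict_rel C (Rel i) | i in ord0 |: degree_set R Rel C].

(* A set of relations is an [s]-class [Q]-polynomial scheme when this holds   *)
(* for some numbering of it and some ordering of the primitive idempotents.   *)
Definition Q_polynomial_scheme (R : realType) (X : finType) (s : nat)
    (RR : {set {set X * X}}) : Prop :=
  exists Rel : 'I_s.+1 -> {set X * X},
    [/\ [set Rel i | i : 'I_s.+1] = RR, assoc_scheme Rel
      & exists E : 'I_s.+1 -> 'M[R]_#|X|, Q_polynomial Rel E].

(* Main.v *)
Require Import Defs.
From HB Require Import structures.
From mathcomp Require Import all_boot all_order all_algebra.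
From mathcomp Require Import reals.
From mathcomp Require Import zify ring.

Set Implicit Arguments.
Unset Strict Implicit.
Unset Printing Implicit Defensive.

Import Order.TTheory GRing.Theory Num.Theory.
Local Open Scope ring_scope.

(* Write v_i for the polynomial of degree i with |X| E_i = v_i(|X| E_1), and  *)
(* F(p) for the restriction of p(|X| E_1) to C, powers being taken            *)
(* entrywise. The matrices F(p) live in the span of the s + 1 relations       *)
(* induced on C, and p is determined by F(p) when deg p <= s.                 *)
(* Let sigma p be the sum of the entries of F(p), so that                     *)
(* tr(F(p) F(q)) = sigma(p q). By hypothesis F(v_k) F(v_(w+l)) = 0 for k < l; *)
(* the three-term recurrence of the v_i and sigma(v_w) != 0 give              *)
(* sigma(v_m v_(w+m)) != 0 for m < s, and F(v_(w+s)) has nonzero diagonal, so *)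
(* the F(v_(w+l)), l <= s, are independent. Hence, for each j, the family     *)
(* F(v_0), ..., F(v_(j-1)), F(v_(w+j)), ..., F(v_(w+s)), whose two halves     *)
(* annihilate each other, is a basis of the span. Subtracting from v_j its    *)
(* component on the first half leaves e_j, of degree j, with F(e_j) F(q) = 0  *)
(* whenever deg q < j. The F(e_j) are thus pairwise orthogonal, and the       *)
(* expansion of the identity on them shows that they are multiples of         *)
(* idempotents.                                                               *)

(** * Orthogonal polynomials *)

(** Two functionals on polynomials interact. The sum of the entries of p(|X| E_1) over all of X
    makes the v_i orthogonal, hence yields their recurrence ([three_term]). The sum sigma over C
    carries the vanishing hypotheses, and the recurrence propagates sigma(v_w) != 0 upwards
    ([entry_sum_mul_n0]). Independence of the mixed families ([mixed_free]) rests on the fact that a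
    real symmetric matrix of square zero is zero, and [orth_polynomials] collects the e_j.

    The scheme structure on C then comes for free ([Q_polynomial_of_orth]). The span of the s + 1
    induced relations contains the identity, so s + 1 nonzero, mutually annihilating symmetric
    matrices in it rescale to idempotents. Their span is closed under multiplication, and this
    closure is the existence of intersection numbers. Since e_1 has degree 1, the restriction of |X|
    E_1 is an affine function of F(e_1), so each F(e_i) is a polynomial of degree i in F(e_1). *)

Lemma size_sub_lead (F : fieldType) (n : nat) (v p : {poly F}) :
    size v = n.+1 -> (size p <= n.+1)%N ->
  (size (p - (p`_n / lead_coef v) *: v)%R <= n)%N.
Proof.
move=> size_v size_p; apply/leq_sizeP => j.
have lead_n0 : lead_coef v != 0 by rewrite lead_coef_eq0 -size_poly_eq0 size_v.
rewrite coefB coefZ leq_eqVlt => /predU1P[<- | lt_nj].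
  by rewrite [v`_n](_ : _ = lead_coef v) ?divfK ?subrr // lead_coefE size_v.
by rewrite (nth_default 0 (leq_trans size_p lt_nj)) [v`_j]nth_default ?size_v //
   mulr0 subr0.
Qed.

Lemma graded_span (F : fieldType) (v : nat -> {poly F}) (n : nat)
    (p : {poly F}) :
    (forall i, (i < n)%N -> size (v i) = i.+1) -> (size p <= n)%N ->
  exists c : nat -> F, p = \sum_(i < n) c i *: v i.
Proof.
elim: n p => [|n IHn] p size_v size_p.
  by exists (fun=> 0); rewrite big_ord0; apply/eqP; rewrite -size_poly_leq0.
have [||c def_p] := IHn (p - (p`_n / lead_coef (v n)) *: v n).
- by move=> i /ltnW lt_in; apply: size_v.
- by apply: size_sub_lead => //; apply: size_v.
- exists (fun i => if i == n then p`_n / lead_coef (v n) else c i).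
  rewrite big_ord_recr /= eqxx -[LHS](subrK (p`_n / lead_coef (v n) *: v n)).
  by rewrite def_p; congr (_ + _); apply: eq_bigr => i _; rewrite ltn_eqF.
Qed.

Lemma graded_free (F : fieldType) (v : nat -> {poly F}) (n : nat)
    (c : nat -> F) :
    (forall i, (i < n)%N -> size (v i) = i.+1) ->
    \sum_(i < n) c i *: v i = 0 ->
  forall i, (i < n)%N -> c i = 0.
Proof.
elim: n => [|n IHn] // size_v sum0.
have size_vn : size (v n) = n.+1 by apply: size_v.
have cn0 : c n = 0.
  have /(congr1 (fun p : {poly F} => p`_n)) := sum0.
  rewrite coef0 big_ord_recr /= coefD coef_sum big1 => [|i _]; last first.
    by rewrite coefZ nth_default ?mulr0 // size_v // ltnS ltnW.
  rewrite add0r coefZ => /eqP; rewrite mulf_eq0 => /orP[/eqP // |].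
  have ->: (v n)`_n = lead_coef (v n) by rewrite lead_coefE size_vn.
  by rewrite lead_coef_eq0 -size_poly_eq0 size_vn.
move=> i; rewrite ltnS leq_eqVlt => /predU1P[-> // |]; apply: IHn.
  by move=> j /ltnW; apply: size_v.
by move: sum0; rewrite big_ord_recr /= cn0 scale0r addr0.
Qed.

(* Polynomial evaluation for the entrywise product, unlike [horner_mx]. *)
Definition hmx (F : fieldType) (n : nat) (M : 'M[F]_n) (p : {poly F}) :
  'M[F]_n := map_mx (horner p) M.

Definition entry_sum (F : fieldType) (n : nat) (M : 'M[F]_n) (p : {poly F}) :
  F := \sum_a \sum_b p.[M a b].

Section EntrywiseHorner.
Variables (F : fieldType) (n : nat) (M : 'M[F]_n).
Implicit Types p q : {poly F}.

Lemma hmxE p a b : hmx M p a b = p.[M a b].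
Proof. exact: mxE. Qed.

Lemma hmx_is_linear : linear (hmx M).
Proof. by move=> a p q; apply/matrixP=> i j; rewrite !mxE hornerD hornerZ. Qed.
HB.instance Definition _ :=
  GRing.isLinear.Build F {poly F} 'M[F]_n *:%R (hmx M) hmx_is_linear.

Lemma entry_sum_is_linear : scalar (entry_sum M).
Proof.
move=> a p q; rewrite /entry_sum mulr_sumr -big_split; apply: eq_bigr => i _.
by rewrite mulr_sumr -big_split; apply: eq_bigr => j _; rewrite hornerD hornerZ.
Qed.
HB.instance Definition _ :=
  GRing.isLinear.Build F {poly F} F *%R (entry_sum M) entry_sum_is_linear.

(** For symmetric [M] the trace sums the entrywise products. Matrix products thus become products of
    polynomials, and a factor 'X can be moved from one side to the other. *)
Lemma mxtrace_hmxM p q :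
  M^T = M -> \tr (hmx M p *m hmx M q) = entry_sum M (p * q).
Proof.
move=> symM; apply: eq_bigr => i _; rewrite mxE; apply: eq_bigr => j _.
by rewrite !mxE hornerM -{2}symM mxE.
Qed.

End EntrywiseHorner.

Section ThreeTermRecurrence.
Variables (F : fieldType) (tau : {scalar {poly F}}).
Variables (d : nat) (v : nat -> {poly F}).
Hypothesis size_v : forall i, (i <= d)%N -> size (v i) = i.+1.
Hypothesis tau_orth : forall i j, (i <= d)%N -> (j <= d)%N -> i != j ->
  tau (v i * v j) = 0.
Hypothesis tau_n0 : forall i, (i <= d)%N -> tau (v i * v i) != 0.

Lemma tau_mul_low (l : nat) (q : {poly F}) :
  (l <= d)%N -> (size q <= l)%N -> tau (q * v l) = 0.
Proof.
move=> le_ld size_q.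
have [|c ->] := graded_span (v := v) _ size_q.
  by move=> i lt_il; apply: size_v; lia.
rewrite mulr_suml linear_sum big1 // => i _.
by rewrite -scalerAl linearZ /= tau_orth ?mulr0 // ?ltn_eqF //;
  have := ltn_ord i; lia.
Qed.

(** Modulo lower degree, which [tau_mul_low] kills, [q] is a nonzero multiple of [v l]. *)
Lemma tau_mul_top_n0 (l : nat) (q : {poly F}) :
  (l <= d)%N -> size q = l.+1 -> tau (q * v l) != 0.
Proof.
move=> le_ld size_q; have size_vl := size_v le_ld.
have size_q1 : (size q <= l.+1)%N by rewrite size_q.
have {size_q1} := size_sub_lead size_vl size_q1.
have: q`_l / lead_coef (v l) != 0.
  by rewrite mulf_neq0 ?invr_eq0 ?lead_coef_eq0 -?size_poly_eq0 ?size_vl //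
     [q`_l](_ : _ = lead_coef q) ?lead_coef_eq0 -?size_poly_eq0 ?size_q
     ?lead_coefE ?size_q.
set a := _ / _ => a_n0 size_r.
rewrite -[q](subrK (a *: v l)) mulrDl linearD /= tau_mul_low // add0r.
by rewrite -scalerAl linearZ /= mulf_neq0 ?tau_n0.
Qed.

(** In the expansion of 'X * v_(k+1), the coefficient of v_h is tau('X v_h v_(k+1)) / tau(v_h v_h).
    As 'X v_h has degree h + 1, this vanishes for h < k and is nonzero for h = k. *)
Lemma three_term (k : nat) : (k.+2 <= d)%N ->
  exists a b c, a != 0
    /\ 'X * v k.+1 = a *: v k + b *: v k.+1 + c *: v k.+2.
Proof.
move=> lt_kd.
have v_n0 i : (i <= d)%N -> v i != 0.
  by move=> le_id; rewrite -size_poly_eq0 size_v.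
have size_Xv i : (i <= d)%N -> size ('X * v i) = i.+2.
  by move=> le_id; rewrite mulrC size_mulX ?v_n0 // size_v.
have [||c def_Xv] := graded_span (v := v) (n := k.+3) (p := 'X * v k.+1).
- by move=> i lt_ik; apply: size_v; lia.
- by rewrite size_Xv //; lia.
have tau_Xv h : (h <= k.+2)%N ->
    tau (('X * v h) * v k.+1) = c h * tau (v h * v h).
  move=> le_hk; rewrite -mulrA mulrCA def_Xv mulr_sumr linear_sum.
  have lt_hk : (h < k.+3)%N by [].
  rewrite (bigD1 (Ordinal lt_hk)) //= big1 => [|i neq_ih].
    by rewrite addr0 -scalerAr linearZ.
  rewrite -scalerAr linearZ /= tau_orth ?mulr0 //.
  - by lia.
  - by have := ltn_ord i; lia.
  - by rewrite eq_sym.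
have c0 h : (h < k)%N -> c h = 0.
  move=> lt_hk; have le_hd : (h <= d)%N by lia.
  have /eqP := tau_Xv h (leqW (leqW (ltnW lt_hk))).
  rewrite tau_mul_low ?size_Xv // ?(ltnW lt_kd) // eq_sym mulf_eq0.
  by rewrite (negPf (tau_n0 le_hd)) orbF => /eqP.
exists (c k), (c k.+1), (c k.+2); split.
  have le_kd : (k <= d)%N by lia.
  have le_kk2 : (k <= k.+2)%N by lia.
  apply: contraTneq (tau_mul_top_n0 (ltnW lt_kd) (size_Xv k le_kd)).
  by rewrite (tau_Xv k le_kk2) => ->; rewrite mul0r eqxx.
rewrite def_Xv !big_ord_recr /= big1 ?add0r // => i _.
by rewrite c0 ?scale0r.
Qed.

End ThreeTermRecurrence.

Lemma free_family_span (K : fieldType) (vT : vectType K) (U : {vspace vT})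
    (m : nat) (f : 'I_m -> vT) :
    (forall c : 'I_m -> K, \sum_i c i *: f i = 0 -> forall i, c i = 0) ->
    (\dim U <= m)%N -> (forall i, f i \in U) ->
  forall u, u \in U -> exists c : 'I_m -> K, u = \sum_i c i *: f i.
Proof.
move=> free_f dimU fU u Uu; pose X := [tuple f i | i < m].
have nth_X (i : 'I_m) : X`_i = f i by rewrite -tnth_nth tnth_mktuple.
have basisX : basis_of U X.
  rewrite basisEfree size_tuple dimU andbT; apply/andP; split.
    apply/freeP => c sum0; apply: free_f; rewrite -[RHS]sum0.
    by apply: eq_bigr => i _; rewrite nth_X.
  by apply/span_subvP => x /tnthP[i ->]; rewrite tnth_mktuple.
exists (fun i => coord X i u); rewrite [LHS](coord_basis basisX Uu).
by apply: eq_bigr => i _; rewrite nth_X.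
Qed.

Lemma mxtrace_mul_tr_eq0 (R : realDomainType) (m n : nat) (A : 'M[R]_(m, n)) :
  \tr (A *m A^T) = 0 -> A = 0.
Proof.
have sqr_ge0_A i : 0 <= (A *m A^T) i i.
  by rewrite mxE sumr_ge0 // => j _; rewrite mxE -expr2 sqr_ge0.
move/eqP; rewrite /mxtrace psumr_eq0 => [/allP AA0 | i _]; last exact: sqr_ge0_A.
apply/matrixP=> i j; have := AA0 i (mem_index_enum i); rewrite !mxE.
rewrite psumr_eq0 => [/allP/(_ j (mem_index_enum j)) | k _].
  by rewrite mxE mulf_eq0 orbb => /eqP.
by rewrite mxE -expr2 sqr_ge0.
Qed.

Lemma sym_sqr_eq0 (R : realDomainType) (n : nat) (A : 'M[R]_n) :
  A^T = A -> A *m A = 0 -> A = 0.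
Proof.
by move=> symA AA0; apply: mxtrace_mul_tr_eq0; rewrite symA AA0 mxtrace0.
Qed.

Section CorePolynomials.
Variables (R : realType) (tau : {scalar {poly R}}).
Variables (d : nat) (v : nat -> {poly R}).
Hypothesis size_v : forall i, (i <= d)%N -> size (v i) = i.+1.
Hypothesis tau_orth : forall i j, (i <= d)%N -> (j <= d)%N -> i != j ->
  tau (v i * v j) = 0.
Hypothesis tau_n0 : forall i, (i <= d)%N -> tau (v i * v i) != 0.

(** [M] stands for the restriction of |X| E_1 to C and [U] for the span of the induced relations,
    while [tau] is the sum of entries over the whole of X. *)
Variables (n : nat) (M : 'M[R]_n) (U : {vspace 'M[R]_n}) (w s : nat).
Hypothesis symM : M^T = M.
Hypothesis dimU : (\dim U <= s.+1)%N.
Hypothesis hmxU : forall p, hmx M p \in U.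
Hypothesis hmx_inj : forall p : {poly R},
  (size p <= s.+1)%N -> hmx M p = 0 -> p = 0.
Hypothesis le_wsd : (w + s <= d)%N.
Hypothesis orthM : forall k l, (k <= w + s)%N -> (l <= w + s)%N ->
  (k + w < l)%N -> hmx M (v k) *m hmx M (v l) = 0.
Hypothesis sum_w_n0 : entry_sum M (v w) != 0.
Hypothesis top_n0 : hmx M (v (w + s)) != 0.

Lemma hmx_sym p : (hmx M p)^T = hmx M p.
Proof. by rewrite /hmx map_trmx symM. Qed.

Lemma hmx_mul_low (q : {poly R}) (l : nat) :
  (l <= s)%N -> (size q <= l)%N -> hmx M q *m hmx M (v (w + l)) = 0.
Proof.
move=> le_ls size_q; have [|c ->] := graded_span (v := v) _ size_q.
  by move=> i lt_il; apply: size_v; lia.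
rewrite linear_sum mulmx_suml big1 // => i _.
by rewrite linearZ /= -scalemxAl orthM ?scaler0 //; have := ltn_ord i; lia.
Qed.

Lemma entry_sum_mul_low (q : {poly R}) (l : nat) :
  (l <= s)%N -> (size q <= l)%N -> entry_sum M (q * v (w + l)) = 0.
Proof.
by move=> le_ls size_q; rewrite -mxtrace_hmxM // hmx_mul_low ?mxtrace0.
Qed.

(** Write q = q_0 + q' 'X with q_0 constant. In the inductive step q_0 contributes nothing, and
    after the recurrence for 'X v_(w+m+1) only the term in q' v_(w+m) survives, with a nonzero
    coefficient. The recurrence reaches v_(w+m+2), whence the strict bound [m < s]. *)
Lemma entry_sum_mul_n0 (m : nat) (q : {poly R}) :
  (m < s)%N -> size q = m.+1 -> entry_sum M (q * v (w + m)) != 0.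
Proof.
elim: m q => [|m IHm] q lt_ms size_q.
  rewrite addn0 (size1_polyC (eq_leq size_q)) mul_polyC linearZ /= mulf_neq0 //.
  by rewrite -polyC_eq0 -size1_polyC ?size_q // -size_poly_eq0 size_q.
have [a [b [c [a_n0 def_Xv]]]] :
    exists a b c, a != 0 /\ 'X * v (w + m).+1 =
      a *: v (w + m) + b *: v (w + m).+1 + c *: v (w + m).+2.
  by apply: (three_term size_v tau_orth tau_n0); lia.
rewrite -(poly_take_drop 1 q) expr1 mulrDl linearD /=.
rewrite entry_sum_mul_low ?(leq_trans (size_take_poly _ _)) // 1?ltnW // add0r.
have size_q' : size (drop_poly 1 q) = m.+1 by rewrite size_drop_poly size_q subn1.
rewrite -mulrA addnS def_Xv !mulrDr !linearD -!scalerAr !linearZ /= -!addnS.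
rewrite !(@entry_sum_mul_low _ m.+1, @entry_sum_mul_low _ m.+2)
  ?size_q' ?(ltnW lt_ms) //.
rewrite !mulr0 !addr0.
by rewrite mulf_neq0 ?IHm // ltnW.
Qed.

(** Multiplying by F(v_l) and taking the trace kills every term of index above l, so the
    coefficients vanish one after the other from l = 0. *)
Lemma upper_free (c : nat -> R) :
    \sum_(l < s.+1) c l *: hmx M (v (w + l)) = 0 ->
  forall l, (l <= s)%N -> c l = 0.
Proof.
move=> sum0; elim/ltn_ind => l IHl le_ls.
have tail0 : \sum_(i < s.+1 | (l <= i)%N) c i *: hmx M (v (w + i)) = 0.
  rewrite -[RHS]sum0 [RHS](bigID (fun i : 'I_s.+1 => (l <= i)%N)) /= [X in _ + X]big1.
    by rewrite addr0.
  move=> i; rewrite -ltnNge => lt_il.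
  by rewrite IHl ?scale0r // ltnW // (leq_trans lt_il).
have lt_ls1 : (l < s.+1)%N by [].
move: tail0; rewrite (bigD1 (Ordinal lt_ls1)) //=.
move: le_ls; rewrite leq_eqVlt => /predU1P[eq_ls | lt_ls].
  rewrite big1 => [|i]; last first.
    rewrite -(inj_eq val_inj) /= => /andP[le_li neq_il].
    by have := ltn_ord i; move/eqP: neq_il; lia.
  by rewrite addr0 eq_ls => /eqP; rewrite scaler_eq0 (negPf top_n0) orbF => /eqP.
move/(congr1 (fun A => \tr (hmx M (v l) *m A))).
rewrite mulmx0 mxtrace0 mulmxDr mxtraceD -scalemxAr mxtraceZ mxtrace_hmxM //.
rewrite mulmx_sumr big1 => [|i].
  rewrite mxtrace0 addr0 => /eqP; rewrite mulf_eq0 => /orP[/eqP // |].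
  by rewrite (negPf (entry_sum_mul_n0 _ _)) // size_v //; lia.
rewrite -(inj_eq val_inj) /= => /andP[le_li neq_il].
rewrite -scalemxAr orthM ?scaler0 //; last by move/eqP: neq_il; lia.
  by lia.
by have := ltn_ord i; lia.
Qed.

(* The two halves of the sum annihilate each other, so each one vanishes. *)
Lemma mixed_free (j : nat) (c : nat -> R) :
    \sum_(k < s.+1)
      c k *: hmx M (v (if (k < j)%N then (k : nat) else (w + k)%N)) = 0 ->
  forall k, (k <= s)%N -> c k = 0.
Proof.
rewrite (bigID (fun k : 'I_s.+1 => (k < j)%N)) /=.
set b := \sum_(k < _ | (k < j)%N) _; set g := \sum_(k < _ | ~~ _) _ => bg0.
have def_b : b = hmx M (\sum_(k < s.+1) (if (k < j)%N then c k else 0) *: v k).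
  rewrite linear_sum /b big_mkcond; apply: eq_bigr => k _.
  by rewrite linearZ /=; case: ifP => lt_kj; rewrite ?lt_kj ?scale0r.
have bg_orth : b *m g = 0.
  rewrite /b mulmx_suml big1 // => k lt_kj; rewrite lt_kj -scalemxAl.
  rewrite /g mulmx_sumr big1 ?scaler0 // => l; rewrite -leqNgt => le_jl.
  rewrite ltnNge le_jl /= -scalemxAr orthM ?scaler0 //.
  - by have := ltn_ord k; lia.
  - by have := ltn_ord l; lia.
  - by lia.
(* From b + g = 0 and b g = 0 follows b b = 0, and b is symmetric. *)
have b0 : b = 0.
  apply: sym_sqr_eq0; first by rewrite def_b hmx_sym.
  by rewrite -[LHS]addr0 -[X in _ + X = _]bg_orth -mulmxDr bg0 mulmx0.
have g0 : g = 0 by rewrite -bg0 b0 add0r.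
move=> k le_ks; case: (ltnP k j) => [lt_kj | le_jk].
  have sum0 : \sum_(k < s.+1) (if (k < j)%N then c k else 0) *: v k = 0.
    apply: hmx_inj; last by rewrite -def_b.
    apply: (leq_trans (size_sum _ _ _)); apply/bigmax_leqP => i _.
    apply: (leq_trans (size_scale_leq _ _)).
    by rewrite size_v //; have := ltn_ord i; lia.
  have size_vs i : (i < s.+1)%N -> size (v i) = i.+1.
    by move=> lt_is; apply: size_v; lia.
  have := graded_free (c := fun k => if (k < j)%N then c k else 0) size_vs sum0.
  by move/(_ k le_ks); rewrite lt_kj.
have sum0 : \sum_(l < s.+1) (if (l < j)%N then 0 else c l) *: hmx M (v (w + l)) = 0.
  rewrite -[RHS]g0 /g [RHS]big_mkcond; apply: eq_bigr => l _ /=.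
  by case: ifP => lt_lj; rewrite ?lt_lj ?scale0r.
have := upper_free (c := fun k => if (k < j)%N then 0 else c k) sum0.
by move/(_ k le_ks); rewrite ltnNge le_jk.
Qed.

(* [v j] minus its component on the first half of the basis of [mixed_free]. *)
Lemma orth_polynomial (j : nat) : (j <= s)%N ->
  exists e : {poly R}, size e = j.+1 /\
    forall q : {poly R}, (size q <= j)%N -> hmx M q *m hmx M e = 0.
Proof.
move=> le_js.
pose f (k : 'I_s.+1) := hmx M (v (if (k < j)%N then (k : nat) else (w + k)%N)).
have free_f c : \sum_i c i *: f i = 0 -> forall i, c i = 0.
  move=> sum0 i.
  have := @mixed_free j (fun k => c (inord k)) _ i _; rewrite inord_val; apply.
    by rewrite -[RHS]sum0; apply: eq_bigr => k _; rewrite inord_val.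
  by rewrite -ltnS.
have [c def_vj] := free_family_span free_f dimU (fun i => hmxU _) (hmxU (v j)).
pose p := \sum_(k < s.+1 | (k < j)%N) c k *: v k.
have size_p : (size p <= j)%N.
  apply: (leq_trans (size_sum _ _ _)); apply/bigmax_leqP => i lt_ij.
  apply: (leq_trans (size_scale_leq _ _)).
  by rewrite size_v //; lia.
exists (v j - p); split; first by rewrite size_polyDl size_v ?size_polyN //; lia.
move=> q size_q.
(* What remains of F(v_j) is a combination of the F(v_(w+i)) with i >= j, all annihilated by F(q)
   because deg q < j. *)
rewrite linearB /= def_vj (bigID (fun k : 'I_s.+1 => (k < j)%N)) /= linear_sum /=.
rewrite [X in X + _ - _](_ : _ = \sum_(i < s.+1 | (i < j)%N) hmx M (c i *: v i)).
  rewrite addrAC subrr add0r mulmx_sumr big1 // => i; rewrite -leqNgt => le_ji.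
  rewrite -scalemxAr /f ltnNge le_ji /= hmx_mul_low ?scaler0 //; first by rewrite -ltnS.
  exact: leq_trans le_ji.
by apply: eq_bigr => i lt_ij; rewrite linearZ /= /f lt_ij.
Qed.

Lemma orth_polynomials : exists e : 'I_s.+1 -> {poly R},
  (forall i, size (e i) = i.+1) /\
  (forall i j, i != j -> hmx M (e i) *m hmx M (e j) = 0).
Proof.
have [e eP] := fin_all_exists (fun i : 'I_s.+1 => orth_polynomial (ltn_ord i)).
exists e; split=> [i|i j neq_ij]; first by case: (eP i).
have low (k l : 'I_s.+1) : (k < l)%N -> hmx M (e k) *m hmx M (e l) = 0.
  by case: (eP l) => _ e_l lt_kl; apply: e_l; case: (eP k) => ->.
case: (ltngtP i j) => [/low // | lt_ji | /val_inj eq_ij].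
  by apply: trmx_inj; rewrite trmx_mul !hmx_sym low ?trmx0.
by rewrite eq_ij eqxx in neq_ij.
Qed.

End CorePolynomials.

(** * Idempotents and Bose-Mesner algebras *)

Section OrthogonalIdempotents.
Variables (R : realType) (n : nat) (B : {vspace 'M[R]_n}).

Lemma orth_span (m : nat) (e : 'I_m -> 'M[R]_n) :
    (forall i, e i \in B) -> (\dim B <= m)%N ->
    (forall i j, i != j -> e i *m e j = 0) ->
    (forall i, e i *m e i != 0) ->
  forall x, x \in B -> exists c : 'I_m -> R, x = \sum_i c i *: e i.
Proof.
move=> eB dimB orth_e sqr_e; apply: free_family_span => // c sum0 i.
have /(congr1 (mulmx (e i))) := sum0.
rewrite mulmx0 mulmx_sumr (bigD1 i) //= big1 => [|j neq_ji]; last first.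
  by rewrite -scalemxAr orth_e ?scaler0 // eq_sym.
move/eqP; rewrite addr0 -scalemxAr scaler_eq0 (negPf (sqr_e i)) orbF.
by move/eqP.
Qed.

(** If a b != 0, then a = a b + (a - a b) would split a into orthogonal idempotents of [B] unless a
    = a b. Used both ways with commutativity, this gives e = e f = f e = f. *)
Lemma primitive_orth (e f : 'M[R]_n) :
    (forall x y, x \in B -> y \in B -> x *m y \in B) ->
    (forall x y, x \in B -> y \in B -> x *m y = y *m x) ->
    primitive_idempotent B e -> primitive_idempotent B f -> e != f ->
  e *m f = 0.
Proof.
move=> mulB commB; set g := e *m f.
have absorb (a b : 'M[R]_n) : primitive_idempotent B a ->
    primitive_idempotent B b -> a *m b != 0 -> a = a *m b.
  case=> [[aB aa] _ irr_a] [[bB bb] _ _] ab_n0; apply/eqP.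
  rewrite -subr_eq0; apply/negPn/negP => a_ab_n0; case: irr_a.
  have abab : a *m b *m (a *m b) = a *m b.
    by rewrite mulmxA -(mulmxA a b a) (commB b a) // !mulmxA aa -mulmxA bb.
  have aab : a *m (a *m b) = a *m b by rewrite mulmxA aa.
  have aba : a *m b *m a = a *m b by rewrite -mulmxA (commB b) // aab.
  exists (a *m b), (a - a *m b); split=> //.
  - by split=> //; apply: mulB.
  - split; first by rewrite memvB ?mulB.
    by rewrite mulmxBl !mulmxBr aa aab aba abab subrr subr0.
  - by rewrite mulmxBl mulmxBr aba aab abab subrr.
  - by rewrite addrC subrK.
move=> prim_e prim_f neq_ef; apply: contraNeq neq_ef => g_n0.
have comm_ef : e *m f = f *m e.
  by case: prim_e prim_f => [[eB _] _ _] [[fB _] _ _]; apply: commB.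
by rewrite (absorb e f) // comm_ef -(absorb f e) // -comm_ef.
Qed.

(** Every element of [B] acts on each [f i] by a scalar, which is 0 or 1 for an idempotent. A
    primitive e with scalar 1 at i splits as f_i + (e - f_i), so it equals f_i; conversely, both
    summands in a splitting of f_i would equal f_i. *)
Lemma primitive_of_orth (m : nat) (f : 'I_m -> 'M[R]_n) :
    (forall i, f i \in B) -> (\dim B <= m)%N ->
    (forall i j, i != j -> f i *m f j = 0) ->
    (forall i, f i *m f i = f i) -> (forall i, f i != 0) ->
  forall e, primitive_idempotent B e <-> exists i, e = f i.
Proof.
move=> fB dimB orth_f idem_f f_n0 e.
have span_f : forall x, x \in B -> exists c : 'I_m -> R, x = \sum_i c i *: f i.
  by apply: orth_span => // i; rewrite idem_f.
have mulf x : x \in B -> exists c : 'I_m -> R, x = \sum_i c i *: f i /\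
    forall i, x *m f i = c i *: f i /\ f i *m x = c i *: f i.
  case/span_f => c ->; exists c; split=> // i; split.
    rewrite mulmx_suml (bigD1 i) //= big1 => [|j neq_ji].
      by rewrite addr0 -scalemxAl idem_f.
    by rewrite -scalemxAl orth_f ?scaler0.
  rewrite mulmx_sumr (bigD1 i) //= big1 => [|j neq_ji].
    by rewrite addr0 -scalemxAr idem_f.
  by rewrite -scalemxAr orth_f ?scaler0 // eq_sym.
have idem_coef x i (c : R) : x *m x = x -> x *m f i = c *: f i -> c = 0 \/ c = 1.
  move=> xx xf; have : x *m (x *m f i) = x *m f i by rewrite mulmxA xx.
  rewrite xf -scalemxAr xf scalerA => /eqP; rewrite -subr_eq0 -scalerBl.
  rewrite scaler_eq0 (negPf (f_n0 i)) orbF -{3}[c]mulr1 -mulrBr mulf_eq0 subr_eq0.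
  by case/orP=> /eqP; [left | right].
split=> [[[eB ee] e_n0 irr_e] | [i ->]].
  have [c [def_e ef]] := mulf e eB.
  have [i ci_n0] : exists i, c i != 0.
    apply/existsP; apply: contraR e_n0; rewrite negb_exists => /forallP c0.
    rewrite def_e big1 // => i _; have := c0 i.
    by rewrite negbK => /eqP ->; rewrite scale0r.
  exists i; have [efi fie] := ef i.
  have ci1 : c i = 1.
    by case: (idem_coef e i _ ee efi) => // ci0; rewrite ci0 eqxx in ci_n0.
  rewrite ci1 scale1r in efi fie.
  apply/eqP; rewrite -subr_eq0; apply/negPn/negP => e_fi_n0; case: irr_e.
  exists (f i), (e - f i); split=> //.
  - split; first by rewrite memvB.
    by rewrite mulmxBl !mulmxBr ee efi fie idem_f subrr subr0.
  - by rewrite mulmxBl mulmxBr efi fie idem_f subrr.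
  - by rewrite addrC subrK.
split=> // -[a [b [[aB aa] [bB bb] [a_n0 b_n0] [ab0 ba0] def_fi]]].
have part x y : x \in B -> x *m x = x -> x != 0 -> x *m y = 0 -> f i = x + y ->
    x = f i.
  move=> xB xx x_n0 xy0 def_f; have [c [_ /(_ i)[xf _]]] := mulf x xB.
  have def_x : x = c i *: f i by rewrite -xf def_f mulmxDr xy0 addr0 xx.
  have [c0 | c1] := idem_coef x i _ xx xf; last by rewrite def_x c1 scale1r.
  by rewrite def_x c0 scale0r eqxx in x_n0.
have def_a : a = f i by apply: (part a b).
have def_b : b = f i by apply: (part b a) => //; rewrite addrC.
by have := f_n0 i; rewrite -(idem_f i) -{1}def_a -def_b ab0 eqxx.
Qed.

End OrthogonalIdempotents.

Lemma sum_enum_val (V : nmodType) (X : finType) (f : X -> V) :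
  \sum_(a < #|X|) f (enum_val a) = \sum_x f x.
Proof. by rewrite [RHS](reindex _ (onW_bij _ (enum_val_bij X))). Qed.

Section RelationsFromClasses.
Variables (R : realType) (X : finType) (d : nat).
Variables (Rel : 'I_d.+1 -> {set X * X}) (cl : X -> X -> 'I_d.+1).
Hypothesis RelE : forall i x y, ((x, y) \in Rel i) = (cl x y == i).

Lemma bose_mesner_sumP (M : 'M[R]_#|X|) :
  M \in bose_mesner R Rel <->
    exists c : 'I_d.+1 -> R, M = \sum_i c i *: adj_mx R (Rel i).
Proof.
have nth_adj (i : 'I_d.+1) :
    [tuple adj_mx R (Rel i) | i < d.+1]`_i = adj_mx R (Rel i).
  by rewrite -tnth_nth tnth_mktuple.
split=> [/coord_span -> | [c ->]].
  exists (fun i => coord [tuple adj_mx R (Rel i) | i < d.+1] i M).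
  by apply: eq_bigr => i _; rewrite nth_adj.
apply: memv_suml => i _; apply: memvZ; apply: memv_span.
by rewrite -nth_adj mem_nth // size_tuple.
Qed.

Lemma bose_mesnerP (M : 'M[R]_#|X|) :
  M \in bose_mesner R Rel <->
    exists c : 'I_d.+1 -> R, forall a b, M a b = c (cl (enum_val a) (enum_val b)).
Proof.
have sumE (c : 'I_d.+1 -> R) a b :
    (\sum_i c i *: adj_mx R (Rel i)) a b = c (cl (enum_val a) (enum_val b)).
  rewrite summxE (bigD1 (cl (enum_val a) (enum_val b))) //= !mxE RelE eqxx mulr1.
  by rewrite big1 ?addr0 // => i neq_i; rewrite !mxE RelE eq_sym (negPf neq_i) mulr0.
split=> [/bose_mesner_sumP[c ->] | [c def_M]]; first by exists c => a b.
by apply/bose_mesner_sumP; exists c; apply/matrixP=> a b; rewrite sumE.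
Qed.

Lemma dim_bose_mesner : (\dim (bose_mesner R Rel) <= d.+1)%N.
Proof. by rewrite (leq_trans (dim_span _)) // size_tuple. Qed.

Lemma bose_mesner_sym (M : 'M[R]_#|X|) :
  (forall x y, cl x y = cl y x) -> M \in bose_mesner R Rel -> M^T = M.
Proof.
by move=> cl_sym /bose_mesnerP[c cM]; apply/matrixP=> a b; rewrite mxE !cM cl_sym.
Qed.

Lemma mem_bose_mesner1 :
  (forall x y, (cl x y == ord0) = (x == y)) -> 1%:M \in bose_mesner R Rel.
Proof.
move=> cl0; apply/bose_mesnerP; exists (fun i => (i == ord0)%:R) => a b.
by rewrite !mxE cl0 (inj_eq enum_val_inj).
Qed.

Lemma adj_mxM (i j : 'I_d.+1) (a b : 'I_#|X|) :
  (adj_mx R (Rel i) *m adj_mx R (Rel j)) a b =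
  #|[set z | ((enum_val a, z) \in Rel i) && ((z, enum_val b) \in Rel j)]|%:R.
Proof.
rewrite mxE -sum1dep_card natr_sum [RHS]big_mkcond -[RHS]sum_enum_val.
by apply: eq_bigr => k _; rewrite !mxE -natrM mulnb; case: (_ && _).
Qed.

Lemma bose_mesner_mul :
    (forall i j k : 'I_d.+1, exists p : nat, forall x y, (x, y) \in Rel k ->
      #|[set z | ((x, z) \in Rel i) && ((z, y) \in Rel j)]| = p) ->
  forall M M' : 'M[R]_#|X|, M \in bose_mesner R Rel ->
    M' \in bose_mesner R Rel -> M *m M' \in bose_mesner R Rel.
Proof.
move=> inter M M' /bose_mesner_sumP[c ->] /bose_mesner_sumP[c' ->].
rewrite mulmx_suml memv_suml // => i _; rewrite mulmx_sumr memv_suml // => j _.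
rewrite -scalemxAl -scalemxAr !memvZ //.
have [p pP] := fin_all_exists (inter i j).
apply/bose_mesnerP; exists (fun k => (p k)%:R) => a b.
by rewrite adj_mxM (pP (cl (enum_val a) (enum_val b))) ?RelE.
Qed.

Lemma bose_mesner_comm :
    (forall x y, cl x y = cl y x) ->
    (forall M M' : 'M[R]_#|X|, M \in bose_mesner R Rel ->
      M' \in bose_mesner R Rel -> M *m M' \in bose_mesner R Rel) ->
  forall M M' : 'M[R]_#|X|, M \in bose_mesner R Rel ->
    M' \in bose_mesner R Rel -> M *m M' = M' *m M.
Proof.
move=> cl_sym mulB M M' BM BM'.
by rewrite -[LHS](bose_mesner_sym cl_sym) ?mulB // trmx_mul !(bose_mesner_sym cl_sym).
Qed.

(** The intersection number for (i, j, k) is the value of A_i A_j on class k, constant there because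
    the product lies in the span. *)
Lemma assoc_scheme_of_mul :
    (forall i, exists x y, cl x y = i) ->
    (forall x y, (cl x y == ord0) = (x == y)) ->
    (forall x y, cl x y = cl y x) ->
    (forall M M' : 'M[R]_#|X|, M \in bose_mesner R Rel ->
      M' \in bose_mesner R Rel -> M *m M' \in bose_mesner R Rel) ->
  assoc_scheme Rel.
Proof.
move=> cl_surj cl0 cl_sym mulB.
have adjB i : adj_mx R (Rel i) \in bose_mesner R Rel.
  apply/bose_mesnerP; exists (fun j => (j == i)%:R) => a b.
  by rewrite mxE RelE.
split.
- move=> i j eq_ij; have [x [y def_i]] := cl_surj i.
  have : (x, y) \in Rel i by rewrite RelE def_i.
  by rewrite eq_ij RelE def_i => /eqP.
- apply/and3P; split.
  + apply/eqP/setP=> -[x y]; rewrite inE; apply/bigcupP.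
    by exists (Rel (cl x y)); rewrite ?RelE ?imset_f.
  + apply/trivIsetP=> _ _ /imsetP[i _ ->] /imsetP[j _ ->] neq_ij.
    apply/pred0P=> -[x y] /=; rewrite !RelE; apply: contraNF neq_ij.
    by case/andP=> /eqP <- /eqP <-.
  + apply/imsetP=> -[i _ /esym /setP eq0]; have [x [y def_i]] := cl_surj i.
    by have := eq0 (x, y); rewrite RelE def_i eqxx inE.
- by apply/setP=> -[x y]; rewrite RelE cl0 inE.
- by move=> i x y; rewrite !RelE cl_sym.
- move=> i j k.
  have /bose_mesnerP[c cP] := mulB _ _ (adjB i) (adjB j).
  have [x0 [y0 def_k]] := cl_surj k.
  exists #|[set z | ((x0, z) \in Rel i) && ((z, y0) \in Rel j)]| => x y.
  rewrite RelE => /eqP def_xy; apply/eqP; rewrite -(eqr_nat R); apply/eqP.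
  have := cP (enum_rank x) (enum_rank y); have := cP (enum_rank x0) (enum_rank y0).
  by rewrite !adj_mxM !enum_rankK def_xy def_k => -> ->.
Qed.

End RelationsFromClasses.

Lemma scheme_class (X : finType) (d : nat) (Rel : 'I_d.+1 -> {set X * X}) :
    assoc_scheme Rel ->
  exists cl : X -> X -> 'I_d.+1,
    [/\ forall i x y, ((x, y) \in Rel i) = (cl x y == i),
        forall i, exists x y, cl x y = i,
        forall x y, (cl x y == ord0) = (x == y)
      & forall x y, cl x y = cl y x].
Proof.
case=> inj_Rel /and3P[/eqP cover_Rel /trivIsetP triv_Rel n0_Rel] diag_Rel sym_Rel _.
have /fin_all_exists[cl0 cl0P] (p : X * X) : exists i, p \in Rel i.
  have : p \in cover [set Rel i | i : 'I_d.+1] by rewrite cover_Rel inE.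
  by case/bigcupP=> _ /imsetP[i _ ->] Rp; exists i.
pose cl x y := cl0 (x, y).
have RelE i x y : ((x, y) \in Rel i) = (cl x y == i).
  apply/idP/eqP=> [Ri | <-]; last exact: cl0P.
  apply: inj_Rel; apply/eqP; apply: contraTT Ri => neq_i.
  have /pred0P/(_ (x, y)) := triv_Rel _ _ (imset_f Rel (erefl (cl x y \in _)))
    (imset_f Rel (erefl (i \in _))) neq_i.
  by rewrite /= cl0P /= => ->.
exists cl; split=> //.
- move=> i; have /set0Pn[[x y] Rxy] : Rel i != set0.
    by apply: contraNneq n0_Rel => <-; apply: imset_f.
  by exists x, y; apply/eqP; rewrite -RelE.
- by move=> x y; rewrite -RelE diag_Rel inE.
- by move=> x y; apply/esym/eqP; rewrite -RelE sym_Rel ?RelE.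
Qed.

Lemma Q_polynomial_of_orth (R : realType) (Y : finType) (s : nat)
    (Rel : 'I_s.+1 -> {set Y * Y}) (cl : Y -> Y -> 'I_s.+1)
    (M : 'M[R]_#|Y|) (e : 'I_s.+1 -> {poly R}) :
    (forall i x y, ((x, y) \in Rel i) = (cl x y == i)) ->
    (forall i, exists x y, cl x y = i) ->
    (forall x y, (cl x y == ord0) = (x == y)) ->
    (forall x y, cl x y = cl y x) ->
    (forall i, size (e i) = i.+1) ->
    (forall i, hmx M (e i) \in bose_mesner R Rel) ->
    (forall i, hmx M (e i) != 0) ->
    (forall i j, i != j -> hmx M (e i) *m hmx M (e j) = 0) ->
  assoc_scheme Rel /\ exists E : 'I_s.+1 -> 'M[R]_#|Y|, Q_polynomial Rel E.
Proof.
move=> RelE cl_surj cl0 cl_sym size_e eB e_n0 orth_e.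
set B := bose_mesner R Rel in eB *.
have dimB : (\dim B <= s.+1)%N by apply: dim_bose_mesner.
have symB A : A \in B -> A^T = A by apply: bose_mesner_sym.
have sqr_n0 i : hmx M (e i) *m hmx M (e i) != 0.
  by apply: contra_neq (e_n0 i) => /sym_sqr_eq0; apply; apply: symB.
have [c def1] := orth_span eB dimB orth_e sqr_n0 (mem_bose_mesner1 R RelE cl0).
(* Multiplying the expansion of the identity by F(e_i) leaves one term; hence c_i F(e_i) is
   idempotent. *)
have sqr_e i : c i *: (hmx M (e i) *m hmx M (e i)) = hmx M (e i).
  rewrite -[RHS]mulmx1 def1 mulmx_sumr (bigD1 i) //= big1 => [|j neq_ji].
    by rewrite addr0 -scalemxAr.
  by rewrite -scalemxAr orth_e ?scaler0 // eq_sym.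
have c_n0 i : c i != 0.
  by apply: contra_neq (e_n0 i) => c0; rewrite -sqr_e c0 scale0r.
pose f i := c i *: hmx M (e i).
have fB i : f i \in B by apply: memvZ.
have f_n0 i : f i != 0 by rewrite scaler_eq0 negb_or c_n0 e_n0.
have idem_f i : f i *m f i = f i.
  by rewrite /f -scalemxAl -scalemxAr sqr_e.
have orth_f i j : i != j -> f i *m f j = 0.
  by move=> neq_ij; rewrite /f -scalemxAl -scalemxAr orth_e // !scaler0.
have mulB A A' : A \in B -> A' \in B -> A *m A' \in B.
  have sqr_f_n0 i : f i *m f i != 0 by rewrite idem_f.
  have span_f := orth_span fB dimB orth_f sqr_f_n0.
  move=> /span_f[a ->] /span_f[a' ->].
  rewrite mulmx_suml memv_suml // => i _; rewrite mulmx_sumr memv_suml // => j _.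
  rewrite -scalemxAl -scalemxAr !memvZ //.
  by have [-> | /orth_f ->] := eqVneq i j; rewrite ?idem_f ?mem0v.
split; first by apply: assoc_scheme_of_mul mulB.
have [x0 _] := cl_surj ord0.
have Y_n0 : #|Y|%:R != 0 :> R.
  by rewrite pnatr_eq0 -lt0n; apply/card_gt0P; exists x0.
(* As e_0 is constant, f_0 = k J; idempotency reads k = k^2 |Y|. *)
have f0 : f ord0 = #|Y|%:R^-1 *: const_mx 1.
  have size_e0 : (size (e ord0) <= 1)%N by rewrite size_e.
  have [k def_f0] : exists k, f ord0 = k *: const_mx 1.
    exists (c ord0 * (e ord0)`_0); apply/matrixP=> a b.
    by rewrite /f (size1_polyC size_e0) !mxE hornerC coefC mulr1.
  have k_n0 : k != 0 by apply: contra_neq (f_n0 ord0) => k0; rewrite def_f0 k0 scale0r.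
  have /matrixP/(_ (enum_rank x0) (enum_rank x0)) := idem_f ord0.
  rewrite def_f0 !mxE (eq_bigr (fun=> k * k)); last by move=> i _; rewrite !mxE mulr1.
  rewrite sumr_const card_ord mulr1 -[(k * k) *+ _]mulr_natr -mulrA => kkY.
  congr (_ *: _); apply: (mulIf Y_n0); rewrite mulVf //; apply: (mulfI k_n0).
  by rewrite kkY mulr1.
exists f; split.
  split=> //; last by apply: primitive_of_orth.
  move=> i j eq_f; apply/eqP; apply: contraNT (f_n0 i) => /orth_f.
  by rewrite -eq_f idem_f => ->.
move=> i; case: (posnP s) => [s0 | s_gt0].
  have all0 (j : 'I_s.+1) : j = ord0.
    by apply: val_inj => /=; have := ltn_ord j; lia.
  exists 1; rewrite size_poly1 (all0 i) (all0 (inord 1)); split=> //.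
  by rewrite f0 scalerA mulfV // scale1r; apply/matrixP=> a b; rewrite !mxE hornerC.
have size_e1 : size (e (inord 1)) = 2 by rewrite size_e inordK.
set p := e (inord 1) in size_e1.
have p1_n0 : p`_1 != 0.
  have -> : p`_1 = lead_coef p by rewrite lead_coefE size_e1.
  by rewrite lead_coef_eq0 -size_poly_eq0 size_e1.
have pE x : p.[x] = p`_0 + p`_1 * x.
  by rewrite horner_coef size_e1 !big_ord_recl big_ord0 /= expr0 expr1 mulr1 addr0.
pose k := #|Y|%:R * c (inord 1).
have k_n0 : k != 0 by rewrite mulf_neq0.
(* The inverse of the affine map x |-> k p(x): since |Y| f_1 = k p(M) entrywise, M = q(|Y| f_1). *)
pose q : {poly R} := (k * p`_1)^-1 *: 'X + (- (p`_0 / p`_1))%:P.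
have kp_n0 : (k * p`_1)^-1 != 0 by rewrite invr_eq0 mulf_neq0.
have size_q : size q = 2.
  by rewrite size_polyDl size_scale ?size_polyX // (leq_ltn_trans (size_polyC_leq1 _)).
exists ((#|Y|%:R * c i) *: (e i \Po q)); split.
  by rewrite size_scale ?mulf_neq0 // size_comp_poly2 ?size_e.
apply/matrixP=> a b; rewrite /f !mxE hornerZ horner_comp mulrA; congr (_ * _.[_]).
rewrite -/p pE /q !hornerE /k.
have := Y_n0; have := c_n0 (inord 1); have := p1_n0.
move: p`_0 p`_1 (c _) (#|Y|%:R) (M a b) => p0 p1 c1 y m p1_neq0 c1_n0 y_n0.
by rewrite /=; field; rewrite y_n0 p1_neq0 c1_n0.
Qed.

(** * Restriction to a subset *)

(** Serves to number the relations met by C so that the diagonal keeps index 0. *)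
Lemma enum_with_first (T : finType) (A : {set T}) (x0 : T) : x0 \notin A ->
  exists g : 'I_#|A|.+1 -> T,
    [/\ injective g, g ord0 = x0
      & forall x, x \in x0 |: A <-> exists i, g i = x].
Proof.
move=> x0A; pose g (i : 'I_#|A|.+1) := oapp enum_val x0 (unlift ord0 i).
exists g; split; last first.
- move=> x; split=> [/setU1P[-> | Ax] | [i <-]].
  + by exists ord0; rewrite /g unlift_none.
  + by exists (lift ord0 (enum_rank_in Ax x)); rewrite /g liftK /= enum_rankK_in.
  + rewrite /g; case: unliftP => [j _ | _] /=; last exact: setU11.
    by rewrite setU1r ?enum_valP.
- by rewrite /g unlift_none.
- move=> i j; rewrite /g.
  case: unliftP => [i' -> | ->]; case: unliftP => [j' -> | ->] //= eq_g.
  + by rewrite (enum_val_inj eq_g).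
  + by rewrite -eq_g enum_valP in x0A.
  + by rewrite eq_g enum_valP in x0A.
Qed.

Lemma sum_sub_carrier (V : nmodType) (X : finType) (C : {set X}) (f : X -> V) :
  \sum_(x in C) f x = \sum_(a < #|sub_carrier C|) f (val (enum_val a)).
Proof.
by rewrite (sum_enum_val (fun x : sub_carrier C => f (val x))) big_sub.
Qed.

(** This turns the dual inner distribution, and the degree set, into sums of entries of restricted
    matrices. *)
Lemma char_vec_form (R : realType) (X : finType) (C : {set X}) (A : 'M[R]_#|X|) :
  ((char_vec R C)^T *m A *m char_vec R C) 0 0 =
  \sum_a \sum_b principal_submx C A a b.
Proof.
have sum_char (G : 'I_#|X| -> R) : \sum_a (enum_val a \in C)%:R * G a =
    \sum_(a < #|sub_carrier C|) G (enum_rank (val (enum_val a))).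
  rewrite -(sum_sub_carrier C (fun x => G (enum_rank x))) [RHS]big_mkcond.
  rewrite -[RHS]sum_enum_val; apply: eq_bigr => a _.
  by rewrite enum_valK; case: (_ \in C); rewrite ?mul1r ?mul0r.
rewrite mxE (eq_bigr (fun b => (enum_val b \in C)%:R *
  \sum_a (enum_val a \in C)%:R * A a b)) => [|b _]; last first.
  by rewrite !mxE mulrC; congr (_ * _); apply: eq_bigr => a _; rewrite !mxE.
rewrite [RHS]exchange_big; apply: (etrans (sum_char _)); apply: eq_bigr => b _.
by apply: (etrans (sum_char _)); apply: eq_bigr => a _; rewrite mxE.
Qed.

Lemma degree_setP (R : realType) (X : finType) (d : nat)
    (Rel : 'I_d.+1 -> {set X * X}) (C : {set X}) (j : 'I_d.+1) :
  j \in degree_set R Rel C <->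
    j != ord0 /\ exists x y : sub_carrier C, (val x, val y) \in Rel j.
Proof.
rewrite inE lt0n char_vec_form.
have entry_ge0 a b : 0 <= principal_submx C (adj_mx R (Rel j)) a b.
  by rewrite !mxE ler0n.
have row_ge0 a : 0 <= \sum_b principal_submx C (adj_mx R (Rel j)) a b.
  exact: sumr_ge0.
split=> [/andP[j_n0] | [j_n0 [x [y Rxy]]]].
  rewrite psumr_eq0 // -has_predC => /hasP[a _] /=.
  rewrite psumr_eq0 // -has_predC => /hasP[b _] /=.
  rewrite !mxE !enum_rankK pnatr_eq0 eqb0 negbK => Rab; split=> //.
  by exists (enum_val a), (enum_val b).
rewrite j_n0 /=; apply: contraTneq Rxy => /eqP.
rewrite psumr_eq0 // => /allP/(_ (enum_rank x) (mem_index_enum _)) /=.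
rewrite psumr_eq0 // => /allP/(_ (enum_rank y) (mem_index_enum _)) /=.
by rewrite !mxE !enum_rankK pnatr_eq0 eqb0.
Qed.

Lemma scheme_idempotents (R : realType) (X : finType) (d : nat)
    (Rel : 'I_d.+1 -> {set X * X}) (E : 'I_d.+1 -> 'M[R]_#|X|) :
    assoc_scheme Rel -> primitive_idempotents Rel E ->
  [/\ forall i, E i \in bose_mesner R Rel,
      forall i j, i != j -> E i *m E j = 0,
      forall i, E i *m E i = E i,
      forall i a, E i a a != 0
    & forall A, A \in bose_mesner R Rel ->
        exists c : 'I_d.+1 -> R, A = \sum_i c i *: E i].
Proof.
move=> hX [inj_E E_all _].
have [cl [RelE cl_surj cl0 cl_sym]] := scheme_class hX.
have prim_E i : primitive_idempotent (bose_mesner R Rel) (E i).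
  by apply/E_all; exists i.
have mulB := bose_mesner_mul (R := R) RelE (scheme_intersection hX).
have commB := bose_mesner_comm RelE cl_sym mulB.
have orth_E i j : i != j -> E i *m E j = 0.
  move=> neq_ij; apply: (primitive_orth mulB commB (prim_E i) (prim_E j)).
  by apply: contra_neq neq_ij => /inj_E.
have EB i : E i \in bose_mesner R Rel by case: (prim_E i) => [[]].
have idem_E i : E i *m E i = E i by case: (prim_E i) => [[]].
have E_n0 i : E i != 0 by case: (prim_E i).
split=> //; last first.
  by apply: orth_span => // [|i]; rewrite ?dim_bose_mesner ?idem_E.
(* The diagonal of E_i is constant, so one zero entry makes tr(E_i E_i^T) = tr(E_i) vanish, and E_i
   with it. *)
move=> i a; apply: contra_neq (E_n0 i) => Eaa0.
apply: mxtrace_mul_tr_eq0; rewrite (bose_mesner_sym RelE cl_sym) // idem_E.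
have /(bose_mesnerP RelE)[c cP] := EB i.
have cl_diag x : cl x x = ord0 by apply/eqP; rewrite cl0.
apply: big1 => b _; rewrite cP cl_diag -(cl_diag (enum_val a)).
by rewrite -cP.
Qed.

Theorem theorem3p6 (R : realType) (X : finType) (d : nat)
    (Rel : 'I_d.+1 -> {set X * X}) (E : 'I_d.+1 -> 'M[R]_#|X|)
    (hX : assoc_scheme Rel) (hQ : Q_polynomial Rel E)
    (C : {set X}) (hC : C != set0)
    (s : nat) (hs : #|degree_set R Rel C| = s)
    (hw : exists w : 'I_d.+1,
       [/\ (w <= d - s)%N, 0 < dual_inner_distribution E C w
         & forall k l : 'I_d.+1, (k <= w + s)%N -> (l <= w + s)%N ->
             (w + 1 <= `|k - l|)%N ->
             principal_submx C (E k) *m principal_submx C (E l) = 0]) :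
  Q_polynomial_scheme R s (induced_relations R Rel C).
Proof.
case: hw => w [le_wds b_gt0 orthF].
have [cl [RelE cl_surj cl0 cl_sym]] := scheme_class hX.
case: hQ => prim_E /fin_all_exists[v0 v0P].
have [EB orth_E idem_E diag_E span_E] := scheme_idempotents hX prim_E.
have [x0 Cx0] := set0Pn _ hC.
have N_n0 : #|X|%:R != 0 :> R.
  by rewrite pnatr_eq0 -lt0n; apply/card_gt0P; exists x0.
pose T := #|X|%:R *: E (inord 1); pose v k := v0 (inord k).
have hmx_v k : hmx T (v k) = #|X|%:R *: E (inord k).
  by case: (v0P (inord k)) => _ /esym.
have size_v k : (k <= d)%N -> size (v k) = k.+1.
  by move=> le_kd; case: (v0P (inord k)) => -> _; rewrite inordK.
have TB : T \in bose_mesner R Rel by apply: memvZ.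
have symT : T^T = T := bose_mesner_sym RelE cl_sym TB.
have [theta thetaP] := (bose_mesnerP RelE _).1 TB.
(* Each adjacency matrix is a combination of the E_k, hence a polynomial in [T] entrywise. If
   [theta] agreed on two classes, that polynomial could not be 1 on one and 0 on the other. *)
have theta_inj : injective theta.
  move=> i j eq_theta; apply/eqP; rewrite -[_ == _]negbK; apply/negP => neq_ij.
  have /span_E[c def_adj] : adj_mx R (Rel i) \in bose_mesner R Rel.
    by apply/(bose_mesnerP RelE); exists (fun k => (k == i)%:R) => a b;
      rewrite mxE RelE.
  pose p := \sum_k (c k / #|X|%:R) *: v k.
  have adjE : adj_mx R (Rel i) = hmx T p.
    rewrite linear_sum def_adj; apply: eq_bigr => k _.
    by rewrite linearZ /= hmx_v inord_val scalerA divfK.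
  have [xi [yi def_i]] := cl_surj i; have [xj [yj def_j]] := cl_surj j.
  have /matrixP/(_ (enum_rank xi) (enum_rank yi)) := adjE.
  have /matrixP/(_ (enum_rank xj) (enum_rank yj)) := adjE.
  rewrite ![adj_mx _ _ _ _]mxE !hmxE !thetaP !enum_rankK !RelE def_i def_j.
  rewrite eqxx eq_theta => <-.
  by rewrite eq_sym (negPf neq_ij) => /eqP; rewrite oner_eq0.
have tau_orth i j : (i <= d)%N -> (j <= d)%N -> i != j ->
    entry_sum T (v i * v j) = 0.
  move=> le_id le_jd neq_ij; rewrite -mxtrace_hmxM // !hmx_v.
  rewrite -scalemxAl -scalemxAr orth_E ?scaler0 ?mxtrace0 //.
  by rewrite -val_eqE /= !inordK.
have tau_n0 i : (i <= d)%N -> entry_sum T (v i * v i) != 0.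
  move=> le_id; rewrite -mxtrace_hmxM // -{2}[hmx T _]hmx_sym //.
  apply: contra_neq (diag_E (inord i) (enum_rank x0)) => /mxtrace_mul_tr_eq0.
  by rewrite hmx_v => /eqP; rewrite scaler_eq0 (negPf N_n0) => /eqP ->; rewrite mxE.
pose D := degree_set R Rel C.
have D0 : ord0 \notin D by rewrite inE.
(* Natural subtraction truncates, so [w <= d - s] gives this only together with s <= d, which holds
   because [D] misses [ord0]. *)
subst s; have le_wsd : (w + #|D| <= d)%N.
  have : D \proper [set: 'I_d.+1].
    by rewrite properT; apply: contraNneq D0 => ->; rewrite inE.
  by move/proper_card; rewrite cardsT card_ord; have := le_wds; rewrite -/D; lia.
have [g [inj_g g0 gP]] := enum_with_first D0.
have memD (x y : sub_carrier C) : exists i, g i = cl (val x) (val y).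
  apply/gP; rewrite in_setU1; have [//| cl_n0] := eqVneq (cl _ _) ord0.
  by apply/degree_setP; split=> //; exists x, y; rewrite RelE.
pose cx0 : sub_carrier C := exist _ x0 Cx0.
have [h hP] := fin_all_exists (fun p : sub_carrier C * sub_carrier C =>
  memD p.1 p.2).
pose cl' x y := h (x, y).
have gcl x y : g (cl' x y) = cl (val x) (val y) by apply: (hP (x, y)).
pose Rel' i := restrict_rel C (Rel (g i)).
have RelE' i x y : ((x, y) \in Rel' i) = (cl' x y == i).
  by rewrite inE RelE -gcl (inj_eq inj_g).
have cl0' x y : (cl' x y == ord0) = (x == y).
  by rewrite -(inj_eq inj_g) g0 gcl cl0 (inj_eq val_inj).
have cl_sym' x y : cl' x y = cl' y x by apply: inj_g; rewrite !gcl cl_sym.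
have cl_surj' i : exists x y, cl' x y = i.
  have /setU1P[gi0 | /degree_setP[_ [x [y]]]] : g i \in ord0 |: D.
  - by apply/gP; exists i.
  - exists cx0, cx0; apply: inj_g; rewrite gcl gi0; apply/eqP.
    by rewrite cl0.
  - by rewrite RelE -gcl (inj_eq inj_g) => /eqP; exists x, y.
pose M := principal_submx C T.
have hmxM p : hmx M p = principal_submx C (hmx T p).
  by apply/matrixP=> a b; rewrite !mxE.
have symM : M^T = M by rewrite /M -{2}symT; apply/matrixP=> a b; rewrite !mxE.
have ME a b : M a b = theta (g (cl' (enum_val a) (enum_val b))).
  by rewrite mxE thetaP !enum_rankK gcl.
have hmxB p : hmx M p \in bose_mesner R Rel'.
  apply/(bose_mesnerP RelE'); exists (fun i => p.[theta (g i)]) => a b.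
  by rewrite mxE ME.
(* All s + 1 distinct values [theta (g i)] occur as entries of [M], which is more roots than a
   nonzero p of degree at most s can have. *)
have hmx_inj (p : {poly R}) : (size p <= #|D|.+1)%N -> hmx M p = 0 -> p = 0.
  move=> size_p p0; apply/eqP; apply: contraTT size_p => p_n0; rewrite -ltnNge.
  have := @max_poly_roots _ p [seq theta (g i) | i <- enum 'I_#|D|.+1] p_n0.
  rewrite size_map size_enum_ord; apply.
    apply/allP=> _ /mapP[i _ ->]; have [x [y <-]] := cl_surj' i.
    have /matrixP/(_ (enum_rank x) (enum_rank y)) := p0.
    by rewrite hmxE ME !enum_rankK mxE => /eqP.
  by rewrite map_inj_uniq ?enum_uniq // => i j /theta_inj /inj_g.
have orthM k l : (k <= w + #|D|)%N -> (l <= w + #|D|)%N -> (k + w < l)%N ->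
    hmx M (v k) *m hmx M (v l) = 0.
  move=> le_k le_l lt_kl; rewrite !hmxM !hmx_v.
  have subZ A : principal_submx C (#|X|%:R *: A) = #|X|%:R *: principal_submx C A.
    by apply/matrixP=> a b; rewrite !mxE.
  have [le_kd le_ld] : (k < d.+1)%N /\ (l < d.+1)%N by lia.
  by rewrite !subZ -scalemxAl -scalemxAr orthF ?scaler0 //= !inordK //; lia.
have sum_w_n0 : entry_sum M (v w) != 0.
  have -> : entry_sum M (v w) = \sum_a \sum_b hmx M (v w) a b.
    by apply: eq_bigr => a _; apply: eq_bigr => b _; rewrite hmxE.
  rewrite hmxM hmx_v inord_val -char_vec_form -scalemxAr -scalemxAl mxE.
  rewrite mulf_neq0 //; apply: contraTneq b_gt0 => sum0.
  by rewrite /dual_inner_distribution sum0 mulr0 ltxx.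
have diag_M k : hmx M (v k) (enum_rank cx0) (enum_rank cx0) != 0.
  by rewrite hmxM hmx_v !mxE mulf_neq0.
have top_n0 : hmx M (v (w + #|D|)%N) != 0.
  by apply: contraNneq (diag_M (w + #|D|)%N) => ->; rewrite mxE.
have [e [size_e orth_e]] := orth_polynomials size_v tau_orth tau_n0 symM
  (dim_bose_mesner R Rel') hmxB hmx_inj le_wsd orthM sum_w_n0 top_n0.
have e_n0 i : hmx M (e i) != 0.
  apply: contra_eq_neq (size_e i) => ei0.
  by rewrite (hmx_inj _ _ ei0) ?size_poly0 ?size_e.
have [schemeC QC] := Q_polynomial_of_orth RelE' cl_surj' cl0' cl_sym' size_e
  (fun i => hmxB (e i)) e_n0 orth_e.
exists Rel'; split=> //; apply/setP=> r.
apply/imsetP/imsetP=> [[i _ ->] | [j Dj ->]].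
  by exists (g i) => //; apply/gP; exists i.
by have [i <-] := (gP j).1 Dj; exists i.
Qed.
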